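(* Let $f_1,\dots,f_n:\mathbb{R}^d\to\mathbb{R}$ be convex and $L$-smooth, let $\sigma>0$, $\kappa=1+L/\sigma$, and let $\theta_\star$ be the minimizer of $\theta\mapsto\sum_{i=1}^n\left[f_i(\theta)+\frac{\sigma}{2}\|\theta\|^2\right]$. For $\varepsilon>0$, the number of steps required by the Token Gradient Descent algorithm (defined in the context) with $1\le K\le n$ tokens and $p_{\rm comp}=p_{\rm comm}=\frac12$ to reach error $\|\theta_t^{{\rm token},k}-\theta_\star\|^2\le\varepsilon$ is of order $$T_{\rm comp}=O\left(\kappa\log\varepsilon^{-1}\right)\quad\text{and}\quad T_{\rm comm}=O\left(\frac{n}{K}\kappa\log\varepsilon^{-1}\right),$$ where $T_{\rm comp}$ is the expected number of gradient steps performed by each node, and $T_{\rm comm}$ is the number of jumps performed per token. In particular, the total communication complexity is the same as that of the algorithm with a single token (namely $O(n\kappa\log\varepsilon^{-1})$ jumps), but the burden is now shared by $K$ tokens that walk the graph in parallel.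
   Context: Each $f_i$ is the local function of node $i$; it is twice continuously differentiable and strictly convex, with $0\preccurlyeq\nabla^2 f_i(x)\preccurlyeq L I_d$ for all $x$. The $n$ nodes are connected by a complete communication graph, so a token may jump from any node to any other. The $O(\cdot)$ ignores the logarithmic dependence on a constant determined by the initialization. Token Gradient Descent with $K\ge1$ tokens, with probabilities $p_{\rm comm}+p_{\rm comp}=1$. Each node $i$ holds a parameter $\theta_t^{(i)}$ and each token $k$ a parameter $\theta_t^{{\rm token},k}$. Parameters: $$\tilde\sigma=\frac{n}{n+K}\sigma,\quad \alpha=\frac{2K}{L},\quad \eta=\min\left(\frac{\tilde\sigma p_{\rm comm}}{2nK},\frac{p_{\rm comp}}{n\alpha(1+L/\tilde\sigma)}\right),\quad \rho_{\rm comm}=\frac{nK\eta}{p_{\rm comm}\tilde\sigma},\quad \rho_{\rm comp}=\frac{n\alpha\eta}{p_{\rm comp}}.$$ Initialization: $z_0^{(i)}\in\mathbb{R}^d$ arbitrary and $\theta_0^{(i)}=-\nabla f_i(z_0^{(i)})/\tilde\sigma$ for $i\in\{1,\dots,n\}$; $\theta_0^{{\rm token},k}=0$ for $k\in\{1,\dots,K\}$. At each iteration $t=0,1,2,\dots$ (variables not mentioned are unchanged): - With probability $p_{\rm comm}$ (communication step): pick $i$ uniformly in $\{1,\dots,n\}$ and $k$ uniformly in $\{1,\dots,K\}$ (token $k$ jumps to node $i$), and set $\theta_{t+1}^{{\rm token},k}=\theta_t^{{\rm token},k}-\rho_{\rm comm}(\theta_t^{{\rm token},k}-\theta_t^{(i)})$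 and $\theta_{t+1}^{(i)}=\theta_t^{(i)}+\rho_{\rm comm}(\theta_t^{{\rm token},k}-\theta_t^{(i)})$. - Otherwise (computation step): pick $i$ uniformly in $\{1,\dots,n\}$ and set $z_{t+1}^{(i)}=(1-\rho_{\rm comp})z_t^{(i)}+\rho_{\rm comp}\theta_t^{(i)}$ and $\theta_{t+1}^{(i)}=\theta_t^{(i)}-\frac{1}{\tilde\sigma}\left(\nabla f_i(z_{t+1}^{(i)})-\nabla f_i(z_t^{(i)})\right)$.
   Formalization: The constant hidden in O(·) is uniform over κ ≥ κ0 for each fixed κ0 > 1 and may depend on κ0; a universal constant fails as κ → 1, since then ρ_comm = L/(2(σ̃+L)) tends to 0 and of order (σ/L) log(1/ε) steps are needed. *)

(* Defs.v *)
From HB Require Import structures.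
From mathcomp Require Import all_boot all_order all_algebra.
From mathcomp Require Import all_classical all_reals all_analysis.
Set Implicit Arguments.
Unset Strict Implicit.
Unset Printing Implicit Defensive.
Import Order.TTheory GRing.Theory Num.Theory.
Import numFieldNormedType.Exports.
Local Open Scope classical_set_scope.
Local Open Scope ring_scope.

Section Functions.
Context {R : realType} {d : nat}.
Implicit Types (x y v : 'rV[R]_d) (f : 'rV[R]_d -> R).

(* The library norm on matrices is the sup norm, hence this definition. *)
Definition sqnorm x : R := \sum_j x 0 j ^+ 2.

Definition grad f x : 'rV[R]_d := \row_j 'D_(delta_mx 0 j) f x.

(* Entry (i, j) is the i-th partial derivative of the j-th component of the
   gradient. *)
Definition hess f x : 'M[R]_d := 'J (grad f) x.

Definition twice_continuously_differentiable f : Prop :=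
  [/\ forall x, differentiable f x,
      forall x, differentiable (grad f) x &
      continuous (hess f)].

Definition strictly_convex f : Prop :=
  forall x y (t : R), x != y -> 0 < t < 1 ->
    f (t *: x + (1 - t) *: y) < t * f x + (1 - t) * f y.

Definition loewner_le (A B : 'M[R]_d) : Prop :=
  forall v, (v *m A *m v^T) 0 0 <= (v *m B *m v^T) 0 0.

Definition local_function (L : R) f : Prop :=
  [/\ twice_continuously_differentiable f,
      strictly_convex f &
      forall x, loewner_le 0 (hess f x) /\ loewner_le (hess f x) L%:M].

Definition is_minimizer f x : Prop := forall y, f x <= f y.

Definition regularized_objective (n : nat) (fs : 'I_n -> 'rV[R]_d -> R)
    (sigma : R) x : R :=
  \sum_(i < n) (fs i x + sigma / 2 * sqnorm x).

End Functions.

(* The random choice made at one iteration: [inl (i, k)] is a communication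
   step in which token k jumps to node i, [inr i] is a computation step at
   node i. *)
Definition draw (n K : nat) : Type := ('I_n * 'I_K + 'I_n)%type.

Definition draw_prob {R : realType} {n K : nat} (p_comm p_comp : R)
    (a : draw n K) : R :=
  match a with
  | inl _ => p_comm / (n%:R * K%:R)
  | inr _ => p_comp / n%:R
  end.

(* The product rule over every finite set of times: with one time it gives the
   law of each draw, and in general the mutual independence of the draws. *)
Definition iid_draws {R : realType} {n K : nat} {disp : measure_display}
    {Omega : measurableType disp} (P : probability Omega R) (p_comm p_comp : R)
    (xi : nat -> Omega -> draw n K) : Prop :=
  (forall t a, measurable [set w | xi t w = a]) /\
  (forall (I : seq nat) (a : nat -> draw n K), uniq I ->
     P (\bigcap_(t in [set` I]) [set w | xi t w = a t]) =
     (\prod_(t <- I) draw_prob p_comm p_comp (a t))%:E).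

Section TokenGradientDescent.
Context {R : realType} {n d : nat} (K : nat).
Variables (f : 'I_n -> 'rV[R]_d -> R) (L sigma p_comm p_comp : R).
Variable z0 : 'I_n -> 'rV[R]_d.

Definition sigma_tilde : R := n%:R / (n%:R + K%:R) * sigma.

Definition tgd_alpha : R := 2 * K%:R / L.

Definition tgd_eta : R :=
  Num.min (sigma_tilde * p_comm / (2 * n%:R * K%:R))
          (p_comp / (n%:R * tgd_alpha * (1 + L / sigma_tilde))).

Definition rho_comm : R := n%:R * K%:R * tgd_eta / (p_comm * sigma_tilde).

Definition rho_comp : R := n%:R * tgd_alpha * tgd_eta / p_comp.

Record tgd_state := TGDState {
  node_z : 'I_n -> 'rV[R]_d ;
  node_theta : 'I_n -> 'rV[R]_d ;
  token_theta : 'I_K -> 'rV[R]_d }.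

Definition update (I : eqType) (V : Type) (u : I -> V) (i : I) (v : V) : I -> V :=
  fun j => if j == i then v else u j.

Definition tgd_init : tgd_state :=
  TGDState z0 (fun i => - (sigma_tilde^-1 *: grad (f i) (z0 i))) (fun=> 0).

Definition tgd_step (s : tgd_state) (a : draw n K) : tgd_state :=
  match a with
  | inl (i, k) =>
      let delta := token_theta s k - node_theta s i in
      TGDState (node_z s)
        (update (node_theta s) i (node_theta s i + rho_comm *: delta))
        (update (token_theta s) k (token_theta s k - rho_comm *: delta))
  | inr i =>
      let z' := (1 - rho_comp) *: node_z s i + rho_comp *: node_theta s i in
      TGDState (update (node_z s) i z')
        (update (node_theta s) i
           (node_theta s i -
            sigma_tilde^-1 *: (grad (f i) z' - grad (f i) (node_z s i))))
        (token_theta s)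
  end.

Fixpoint tgd (a : nat -> draw n K) (t : nat) : tgd_state :=
  if t is s.+1 then tgd_step (tgd a s) (a s) else tgd_init.

End TokenGradientDescent.

Section Counting.
Context {n K : nat}.
Implicit Types (a : nat -> draw n K) (T : nat).

Definition gradient_steps a T (i : 'I_n) : nat :=
  \sum_(t < T) (a t == inr i).

Definition token_jumps a T (k : 'I_K) : nat :=
  \sum_(t < T) [exists i : 'I_n, a t == inl (i, k)].

Definition total_jumps a T : nat := \sum_(k < K) token_jumps a T k.

End Counting.

(* Main.v *)
Require Import Defs.
From HB Require Import structures.
From mathcomp Require Import all_boot all_order all_algebra.
From mathcomp Require Import all_classical all_reals all_analysis.
From mathcomp Require Import measurable_realfun ring lra.
Set Implicit Arguments.
Unset Strict Implicit.
Unset Printing Implicit Defensive.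
Import Order.TTheory GRing.Theory Num.Theory.
Import numFieldNormedType.Exports.
Local Open Scope classical_set_scope.
Local Open Scope ring_scope.

(** Write ts for the minimizer, st for sigma_tilde, and measure everything
    from the optimum: e_i = theta_i - ts at the nodes, u_k for the tokens,
    w_i = z_i - ts, and g_i = (grad f_i z_i - grad f_i ts) / st.

    Token gradient descent is randomized coordinate descent on a dual problem.
    Give each of the n nodes and K tokens the regularizer st/2 |.|^2 (their sum
    is n sigma/2 |.|^2, since (n + K) st = n sigma) and impose consensus along
    the edges of the complete bipartite graph between nodes and tokens, plus one
    virtual edge per node behind which f_i sits.  A communication step updates
    the dual variable of a real edge, a computation step that of a virtual
    edge, which is stored through its mirror image z_i.  Up to
    the factor st, the real edges have contributed y_i = e_i + g_i at node i and
    u_k at token k; an edge moves the same amount in and out, so sum y + sum u is conserved.  It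
    vanishes at initialization precisely because ts is stationary
    (imbalance_step, imbalance_init).

    Convergence comes from the Lyapunov function
      lyap = st^2/(nL) comm_energy + primal_breg + 2 rho dual_gap,
    with rho = st/(L + st) the computation step size.  The first two terms are
    the distance to the optimum in the mirror geometry: comm_energy is, on
    zero-sum vectors, nK times the squared norm of (y, u) for the
    pseudo-inverse of the graph Laplacian, and primal_breg sums the Bregman
    divergences of z_i from ts.  On average over a step their
    first-order decrease is proportional to
      dissipation = sum |e|^2 + sum |u|^2 + sum <g, w>,
    and the second-order errors are paid for by the dual gap: with these step
    sizes its weighted decrease in every single step is at least the error of
    that step (comm_step_lyap, comp_step_lyap).  Hence, in expectation,
    lyap drops by st rho/(2n) dissipation (mean_lyap_step); conversely lyap is
    at most (5 + 2 st/L) st dissipation (lyap_le_dissipation), because f_i is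
    convex and L-smooth.  The result is a contraction of the expected lyap by
    the factor 1 - rho/(2n(5 + 2 st/L)) per iteration.

    As K <= n gives sigma/2 <= st <= sigma, one has rho >= 1/(2 kappa), and
    st/L <= 1/(kappa0 - 1), so the factor is at most 1 - 1/(n kappa A) with A
    depending on kappa0 only (contraction_le).  About n kappa A log(1/eps)
    iterations therefore suffice; on average, half of them are gradient steps
    shared by n nodes and the other half are jumps shared by K tokens.  The gap
    between kappa0 and 1 matters because the communication step size tends to 0
    with L/sigma, so that tokens move slowly when kappa is close to 1.

    The expectations are finite sums: the iterate at time t depends only on the
    first t draws, whose joint law is a product (expectation_draws). *)

(** * Euclidean inner product on row vectors *)

Section InnerProduct.
Context {R : realType} {d : nat}.
Implicit Types (x y z : 'rV[R]_d) (c : R).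

Definition dot x y : R := \sum_j x 0 j * y 0 j.

Lemma dotC x y : dot x y = dot y x.
Proof. by apply: eq_bigr => j _; rewrite mulrC. Qed.

Lemma dotDl x y z : dot (x + y) z = dot x z + dot y z.
Proof. by rewrite /dot -big_split; apply: eq_bigr => j _; rewrite mxE mulrDl. Qed.

Lemma dotDr x y z : dot z (x + y) = dot z x + dot z y.
Proof. by rewrite dotC dotDl !(dotC _ z). Qed.

Lemma dotZl c x y : dot (c *: x) y = c * dot x y.
Proof. by rewrite /dot mulr_sumr; apply: eq_bigr => j _; rewrite mxE mulrA. Qed.

Lemma dotZr c x y : dot x (c *: y) = c * dot x y.
Proof. by rewrite dotC dotZl dotC. Qed.

Lemma dotNl x y : dot (- x) y = - dot x y.
Proof. by rewrite -scaleN1r dotZl mulN1r. Qed.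

Lemma dotNr x y : dot x (- y) = - dot x y.
Proof. by rewrite dotC dotNl dotC. Qed.

Lemma dot0l x : dot 0 x = 0.
Proof. by rewrite -(scale0r 0) dotZl mul0r. Qed.

Lemma dot_suml (I : finType) (F : I -> 'rV[R]_d) x :
  dot (\sum_i F i) x = \sum_i dot (F i) x.
Proof. by apply: (big_morph (dot^~ x)) => [y z|]; rewrite (dotDl, dot0l). Qed.

Lemma dot_sumr (I : finType) (F : I -> 'rV[R]_d) x :
  dot x (\sum_i F i) = \sum_i dot x (F i).
Proof. by rewrite dotC dot_suml; under eq_bigr do rewrite dotC. Qed.

Lemma sqnormE x : sqnorm x = dot x x.
Proof. by apply: eq_bigr => j _; rewrite expr2. Qed.

Lemma dotxx_ge0 x : 0 <= dot x x.
Proof. by rewrite -sqnormE; apply: sumr_ge0 => j _; exact: sqr_ge0. Qed.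

Lemma dotxx_eq0 x : dot x x = 0 -> x = 0.
Proof.
rewrite -sqnormE => /eqP; rewrite psumr_eq0 => [/allP x0|j _]; last exact: sqr_ge0.
by apply/rowP => j; have := x0 j (mem_index_enum j); rewrite /= sqrf_eq0 mxE => /eqP.
Qed.

Definition dotE := (dotDl, dotDr, dotNl, dotNr, dotZl, dotZr).

Lemma dotxxD_le x y : dot (x + y) (x + y) <= 2 * dot x x + 2 * dot y y.
Proof.
have := dotxx_ge0 (x - y); rewrite !dotE (dotC y x); lra.
Qed.

Lemma dotxxDZ x c y :
  dot (x + c *: y) (x + c *: y) = dot x x + (2 * c * dot x y + c ^+ 2 * dot y y).
Proof. rewrite !dotE (dotC y x); ring. Qed.

Lemma dotxxB x y : dot (x - y) (x - y) = dot x x + dot y y - 2 * dot x y.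
Proof. rewrite !dotE (dotC y x); ring. Qed.

End InnerProduct.

(** * Derivatives along lines *)

Section Smooth.
Context {R : realType} {d : nat}.
Implicit Types (x y v : 'rV[R]_d) (f : 'rV[R]_d -> R).

(** The inner product as a function of its left argument, so that it can carry
    a linear structure. *)
Definition dotr v x : R := dot x v.

Let dotr_linear v : linear (dotr v).
Proof. by move=> c x y; rewrite /dotr dotDl dotZl. Qed.

HB.instance Definition _ v := GRing.isLinear.Build R 'rV[R]_d R _ (dotr v)
  (dotr_linear v).

Lemma differentiable_dotr v x : differentiable (dotr v) x.
Proof.
rewrite (_ : dotr v = \sum_j ((fun u : 'rV[R]_d => u 0 j : R) * cst (v 0 j))); last first.
  by apply/funext => u; rewrite fct_sumE.
apply: differentiable_sum => j.
apply: differentiableM; [exact: differentiable_coord|exact: differentiable_cst].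
Qed.

Let diff_dotr v x : 'd (dotr v) x = dotr v :> (_ -> _).
Proof.
apply: diff_lin => y; apply: differentiable_continuous.
exact: differentiable_dotr.
Qed.

Lemma derive_grad f x v : differentiable f x -> 'D_v f x = dot (grad f x) v.
Proof.
move=> df; rewrite deriveE // {1}(row_sum_delta v) linear_sum /=.
by apply: eq_bigr => j _; rewrite linearZ /= mxE deriveE // mulrC.
Qed.

Lemma derive_dot_grad f x v w : differentiable (grad f) x ->
  'D_v (fun u => dot (grad f u) w) x = dot (v *m hess f x) w.
Proof.
move=> dg; rewrite -deriveEjacobian // deriveE; last first.
  exact: (differentiable_comp dg (differentiable_dotr w _)).
rewrite (deriveE v dg).
rewrite -[RHS]/(dotr w ('d (grad f) x v)) -(diff_dotr w (grad f x)).
exact: (congr1 (fun F => F v) (diff_comp dg (differentiable_dotr w _))).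
Qed.

(** The difference quotients of the two sides are the same function. *)
Lemma is_derive_line f x v (t : R) : differentiable f (x + t *: v) ->
  is_derive t (1 : R) (fun s => f (x + s *: v)) ('D_v f (x + t *: v)).
Proof.
move=> df.
have E : (fun h : R => h^-1 *: (((fun s => f (x + s *: v)) \o shift t) (h *: (1 : R))
     - f (x + t *: v))) =
  (fun h : R => h^-1 *: ((f \o shift (x + t *: v)) (h *: v) - f (x + t *: v))).
  apply/funext => h /=; congr (_ *: (f _ - _)).
  by rewrite [h *: _]mulr1 scalerDl addrCA addrA.
apply: DeriveDef; last by rewrite /derive E.
by rewrite /derivable E; exact: diff_derivable.
Qed.

End Smooth.

(** * Bregman divergences of convex smooth functions *)

Section Bregman.
Context {R : realType} {d : nat}.
Implicit Types (x y v : 'rV[R]_d) (f : 'rV[R]_d -> R).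

(** The Bregman divergence of f: the gap at x between f and its tangent at y. *)
Definition breg f x y : R := f x - f y - dot (grad f y) (x - y).

(** Taylor's formula with Lagrange remainder on the segment from y to x.  The
    quadratic term is subtracted with the very coefficient that makes the
    auxiliary function take equal values at both ends, so two uses of the mean
    value theorem produce an exact second-order point. *)
Lemma breg_lagrange f x y : twice_continuously_differentiable f ->
  exists u, breg f x y = 2^-1 * dot ((x - y) *m hess f u) (x - y).
Proof.
move=> [df dg _]; set v := x - y; set m := 2 * breg f x y.
pose h' (t : R) := dot (grad f (y + t *: v)) v.
have dh (t : R) : is_derive t (1 : R) (fun s => f (y + s *: v)) (h' t).
  by rewrite /h' -derive_grad //; exact: is_derive_line.
pose k (t : R) := f (y + t *: v) - t * h' 0 - t * t * breg f x y.
have dk (t : R) : is_derive t (1 : R) k (h' t - h' 0 - t * m).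
  rewrite /k; apply: is_derive_eq.
  by rewrite /m /GRing.scale /=; ring.
have k01 : k 1 - k 0 = 0.
  rewrite /k /h' /breg !scale1r !scale0r !addr0 -/v (addrC y v) subrK; ring.
have [|c] := @MVT R k _ 0 1 ltr01 (fun t _ => dk t).
- apply: derivable_within_continuous => t _; exact: (@ex_derive _ _ _ _ _ _ _ (dk t)).
rewrite in_itv /= k01 subr0 mulr1 => /andP[c0 _] hc.
have dh' (t : R) : is_derive t (1 : R) h' (dot (v *m hess f (y + t *: v)) v).
  have diffh : differentiable (fun u => dot (grad f u) v) (y + t *: v).
    exact: (differentiable_comp (dg _) (differentiable_dotr v _)).
  have := is_derive_line diffh; rewrite (derive_dot_grad _ _ (dg _)); exact.
have [|b _ hb] := @MVT R h' _ 0 c c0 (fun t _ => dh' t).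
- apply: derivable_within_continuous => t _; exact: (@ex_derive _ _ _ _ _ _ _ (dh' t)).
exists (y + b *: v); move: hc; rewrite hb subr0 /m.
move=> /esym/eqP; rewrite (mulrC c) -mulrBl mulf_eq0 (gt_eqF c0) orbF => /eqP.
lra.
Qed.

Lemma breg_bounds L f x y : local_function L f ->
  0 <= breg f x y <= L / 2 * dot (x - y) (x - y).
Proof.
move=> [f2 _ fL]; have [u ->] := breg_lagrange x y f2.
have [H0 HL] := fL u.
have E (A : 'M[R]_d) v : (v *m A *m v^T) 0 0 = dot (v *m A) v.
  by rewrite mxE; apply: eq_bigr => j _; rewrite [v^T _ _]mxE.
move: (H0 (x - y)) (HL (x - y)); rewrite !E mulmx0 dot0l mul_mx_scalar dotZl.
lra.
Qed.

Lemma breg_sym f x y :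
  breg f x y + breg f y x = dot (grad f x - grad f y) (x - y).
Proof. rewrite /breg !dotE; ring. Qed.

(** Moving the first argument of a divergence, as z_i does with respect to the
    optimum, costs a second-order term plus a first-order one. *)
Lemma breg_three_points f x' x y :
  breg f x' y - breg f x y = breg f x' x + dot (grad f x - grad f y) (x' - x).
Proof. rewrite /breg !dotE; ring. Qed.

(** The same for the second argument, which is what the dual gap sees. *)
Lemma breg_three_points_dual f y x' x :
  breg f y x' - breg f y x = breg f x x' + dot (grad f x' - grad f x) (x - y).
Proof. rewrite /breg !dotE; ring. Qed.

(** One gradient step of length 1/L from x on f minus its linear part at y: the
    upper quadratic bound at x says how far it descends, and convexity says it
    cannot descend below the value at y. *)
Lemma breg_ge_grad L f x y : 0 < L -> local_function L f ->
  dot (grad f x - grad f y) (grad f x - grad f y) <= 2 * L * breg f x y.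
Proof.
move=> L0 fL; set g := grad f x - grad f y.
have /andP[lo _] := breg_bounds (x - L^-1 *: g) y fL.
have /andP[_] := breg_bounds (x - L^-1 *: g) x fL.
move: lo; rewrite /breg.
have -> : x - L^-1 *: g - x = - (L^-1 *: g) by rewrite addrAC subrr add0r.
have -> : x - L^-1 *: g - y = (x - y) - L^-1 *: g by rewrite addrAC.
have gg : dot g g = dot (grad f x) g - dot (grad f y) g by rewrite -dotNl -dotDl.
rewrite (dotDr (x - y)) !(dotNl, dotNr) !(dotZl, dotZr) !opprK.
have -> : L / 2 * (L^-1 * (L^-1 * dot g g)) = L^-1 * dot g g / 2.
  by field; rewrite gt_eqF.
move=> lo hi.
have := congr1 ( *%R L^-1) gg; rewrite mulrBr => {}gg.
have : L^-1 * dot g g <= 2 * (f x - f y - dot (grad f y) (x - y)) by lra.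
by rewrite ler_pdivrMl // mulrA (mulrC L).
Qed.

Lemma cocoercive L f x y : 0 < L -> local_function L f ->
  dot (grad f x - grad f y) (grad f x - grad f y)
    <= L * dot (grad f x - grad f y) (x - y).
Proof.
move=> L0 fL; have := breg_ge_grad x y L0 fL; have := breg_ge_grad y x L0 fL.
have -> : dot (grad f y - grad f x) (grad f y - grad f x)
   = dot (grad f x - grad f y) (grad f x - grad f y) by rewrite !dotE; ring.
rewrite -breg_sym; nra.
Qed.

End Bregman.

(** * First-order optimality *)

Section Minimizer.
Context {R : realType} {n d : nat}.
Variables (f : 'I_n -> 'rV[R]_d -> R) (L sigma : R) (ts : 'rV[R]_d).
Hypotheses (L0 : 0 < L) (s0 : 0 < sigma) (fL : forall i, local_function L (f i)).

(** The smoothness bound makes the objective at ts - h G at most its minimum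
    minus h |G|^2 plus c h^2 |G|^2, for G the gradient at ts; a small h > 0 then
    forces G = 0, without differentiating the objective itself. *)
Lemma minimizer_stationary : is_minimizer (regularized_objective f sigma) ts ->
  \sum_i grad (f i) ts + (n%:R * sigma) *: ts = 0.
Proof.
move=> tsmin; move GE: (LHS) => G.
apply: dotxx_eq0; apply/eqP.
rewrite eq_le dotxx_ge0 andbT.
have [D DE] : exists D, D = dot G G by exists (dot G G).
have D_sum : D = \sum_i dot (grad (f i) ts + sigma *: ts) G.
  rewrite DE -{1}GE -dot_suml big_split /= sumr_const card_ord.
  by rewrite -(scaler_nat n (sigma *: ts)) scalerA.
rewrite -DE; set c := n%:R * ((L + sigma) / 2).
have quad (h : R) : h * D <= c * (h * h * D).
  have hmin := tsmin (ts - h *: G).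
  rewrite /regularized_objective -subr_ge0 -sumrB in hmin.
  have -> : c * (h * h * D) = \sum_(i < n) (L + sigma) / 2 * (h * h * D).
    by rewrite sumr_const card_ord /c -mulrA mulr_natl.
  rewrite {1}D_sum mulr_sumr -subr_ge0 -sumrB.
  apply: le_trans hmin _; apply: ler_sum => i _.
  have /andP[_] := breg_bounds (ts - h *: G) ts (fL i).
  rewrite /breg (addrAC ts) subrr add0r !sqnormE !dotE (dotC G ts) DE.
  lra.
have c0 : 0 <= c by rewrite mulr_ge0 // divr_ge0 // addr_ge0 ?ltW.
have D0 : 0 <= D by rewrite DE dotxx_ge0.
have cp : 0 < 2 * (c + 1) by lra.
(* Any h with 0 < h c < 1 works; the + 1 covers c = 0. *)
have := quad (2 * (c + 1))^-1; set h := _^-1.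
have hh : h * (2 * (c + 1)) = 1 by rewrite mulVf // gt_eqF.
have h0 : 0 < h by rewrite invr_gt0.
rewrite -mulrA mulrCA ler_pM2l //.
have -> : c * (h * D) = (h * (2 * (c + 1)) - 2 * h) / 2 * D by field.
rewrite hh; nra.
Qed.

End Minimizer.

(** * Sums over a family changed at one index *)

Lemma sum_change_at (V : zmodType) (I : finType) (F G : I -> V) (i : I) :
  (forall j, j != i -> F j = G j) -> \sum_j F j = \sum_j G j - G i + F i.
Proof.
move=> FG; rewrite (bigD1 i) //= [in RHS](bigD1 i) //= (eq_bigr _ FG).
by rewrite [G i + _]addrC addrK addrC.
Qed.

Lemma updateE (I : eqType) (V : Type) (u : I -> V) i v : update u i v i = v.
Proof. by rewrite /update eqxx. Qed.

Lemma update_neq (I : eqType) (V : Type) (u : I -> V) i v j :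
  j != i -> update u i v j = u j.
Proof. by rewrite /update => /negPf ->. Qed.

Lemma sum_update (V : zmodType) (I : finType) (u : I -> V) i v :
  \sum_j update u i (u i + v) j = \sum_j u j + v.
Proof.
rewrite (sum_change_at (i := i) (G := u)) => [|j]; last exact: update_neq.
by rewrite updateE addrA subrK.
Qed.

Lemma sum_dotxx_update (R : realType) (d : nat) (I : finType) (u : I -> 'rV[R]_d)
    i c (x : 'rV[R]_d) :
  let u' := update u i (u i + c *: x) in
  \sum_j dot (u' j) (u' j) =
  \sum_j dot (u j) (u j) + (2 * c * dot (u i) x + c ^+ 2 * dot x x).
Proof.
move=> u'; rewrite (sum_change_at (i := i) (G := fun j => dot (u j) (u j))).
  by rewrite /u' updateE dotxxDZ addrA subrK.
by move=> j ji; rewrite /u' update_neq.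
Qed.

(** * Step sizes in closed form *)

Section StepSizes.
Context {R : realType} (n K : nat) (L sigma : R).
Hypotheses (L0 : 0 < L) (sigma0 : 0 < sigma) (n0 : (0 < n)%N) (K0 : (0 < K)%N).

Let N0 : 0 < n%:R :> R. Proof. by rewrite ltr0n. Qed.
Let k0 : 0 < K%:R :> R. Proof. by rewrite ltr0n. Qed.
Local Notation st := (@sigma_tilde R n K sigma).

Lemma sigma_tilde_gt0 : 0 < st.
Proof. by rewrite mulr_gt0 // divr_gt0 // addr_gt0. Qed.

(** The two candidates for eta differ by the factor (L + st)/L > 1, so the
    computation bound is always the binding one. *)
Lemma tgd_etaE :
  @tgd_eta R n K L sigma (1 / 2) (1 / 2) = L * st / (4 * n%:R * K%:R * (L + st)).
Proof.
rewrite /tgd_eta /tgd_alpha; have s0 := sigma_tilde_gt0; move: st s0 => s s0.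
have Ls : 0 < L + s by rewrite addr_gt0.
have -> : 1 / 2 / (n%:R * (2 * K%:R / L) * (1 + L / s))
    = L * s / (4 * n%:R * K%:R * (L + s)).
  field; rewrite ?gt_eqF //= ?(addrC s) ?gt_eqF // ?mulr_gt0 //; lra.
apply: min_r.
have -> : s * (1 / 2) / (2 * n%:R * K%:R) = s * (L + s) / (4 * n%:R * K%:R * (L + s)).
  by field; rewrite ?gt_eqF.
rewrite ler_pM2r ?invr_gt0 ?mulr_gt0 //; nra.
Qed.

Lemma rho_commE :
  @rho_comm R n K L sigma (1 / 2) (1 / 2) = L / (2 * (L + st)).
Proof.
rewrite /rho_comm tgd_etaE; have s0 := sigma_tilde_gt0; move: st s0 => s s0.
by field; rewrite ?gt_eqF // addr_gt0.
Qed.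

Lemma rho_compE : @rho_comp R n K L sigma (1 / 2) (1 / 2) = st / (L + st).
Proof.
rewrite /rho_comp tgd_etaE /tgd_alpha.
have s0 := sigma_tilde_gt0; move: st s0 => s s0.
by field; rewrite ?gt_eqF // addr_gt0.
Qed.

End StepSizes.

(** * The Lyapunov function *)

Section Lyapunov.
Context {R : realType} {n d K : nat}.
Variables (f : 'I_n -> 'rV[R]_d -> R) (L sigma : R) (ts : 'rV[R]_d).
Hypotheses (L0 : 0 < L) (sigma0 : 0 < sigma).
Hypothesis fL : forall i, local_function L (f i).
Hypotheses (n0 : (0 < n)%N) (K0 : (0 < K)%N) (Kn : (K <= n)%N).

Let N0 : 0 < n%:R :> R. Proof. by rewrite ltr0n. Qed.
Let k0 : 0 < K%:R :> R. Proof. by rewrite ltr0n. Qed.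
Let kN : K%:R <= n%:R :> R. Proof. by rewrite ler_nat. Qed.

Local Notation st := (@sigma_tilde R n K sigma).
Local Notation rho := (st / (L + st)).
Local Notation rhoc := (L / (2 * (L + st))).
Local Notation step := (@tgd_step R n d K f L sigma (1 / 2) (1 / 2)).
Local Notation state := (@tgd_state R n d K).
Implicit Types (s : state) (i : 'I_n) (k : 'I_K).

Definition node_err s i := node_theta s i - ts.
Definition token_err s k := token_theta s k - ts.
Definition z_err s i := node_z s i - ts.
Definition grad_err s i := st^-1 *: (grad (f i) (node_z s i) - grad (f i) ts).
(** Adding grad_err cancels the effect of computation steps on theta_i: this
    is the part of node i that only communication changes. *)
Definition comm_var s i := node_err s i + grad_err s i.

Definition imbalance s := \sum_i comm_var s i + \sum_k token_err s k.

(** The suboptimality of the dual objective. Its non-quadratic part is the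
    divergence of the conjugate of f_i between dual points, which is that of f_i
    with arguments exchanged; hence breg with ts first. *)
Definition dual_gap s :=
  st / 2 * (\sum_i dot (node_err s i) (node_err s i)
            + \sum_k dot (token_err s k) (token_err s k))
  + \sum_i breg (f i) ts (node_z s i).

Definition primal_breg s := \sum_i breg (f i) (node_z s i) ts.

(** nK times the squared norm of (comm_var, token_err) for the
    pseudo-inverse of the Laplacian of the complete bipartite graph, on vectors
    of total sum zero.  That Laplacian has eigenvalues K, n and n + K; the
    projections combine into this closed form. *)
Definition comm_energy s :=
  n%:R * \sum_i dot (comm_var s i) (comm_var s i)
  + K%:R * \sum_k dot (token_err s k) (token_err s k)
  - dot (\sum_i comm_var s i) (\sum_i comm_var s i).

(** The weight of comm_energy makes the cross terms <g_i, e_i> produced by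
    communication and computation cancel on average; that of dual_gap is what
    absorbs the second-order terms of both kinds of step. *)
Definition lyap s :=
  st ^+ 2 / (n%:R * L) * comm_energy s + primal_breg s + 2 * rho * dual_gap s.

Definition dissipation s :=
  \sum_i dot (node_err s i) (node_err s i)
  + \sum_k dot (token_err s k) (token_err s k)
  + \sum_i dot (grad_err s i) (z_err s i).

Let s0 : 0 < st. Proof. exact: sigma_tilde_gt0. Qed.
Let Ls0 : 0 < L + st. Proof. by rewrite addr_gt0. Qed.
Let rho_gt0 : 0 < rho. Proof. by rewrite divr_gt0. Qed.

Lemma comm_step_node_err s i k :
  node_err (step s (inl (i, k))) =
  update (node_err s) i (node_err s i + rhoc *: (token_err s k - node_err s i)).
Proof.
apply/funext => j; rewrite /node_err /token_err /= rho_commE // /update.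
by case: eqP => // _; rewrite addrAC opprB addrA subrK.
Qed.

Lemma comm_step_token_err s i k :
  token_err (step s (inl (i, k))) =
  update (token_err s) k (token_err s k + - rhoc *: (token_err s k - node_err s i)).
Proof.
apply/funext => j; rewrite /node_err /token_err /= rho_commE // /update.
by case: eqP => // _; rewrite addrAC opprB addrA subrK scaleNr.
Qed.

Lemma comm_step_comm_var s i k :
  comm_var (step s (inl (i, k))) =
  update (comm_var s) i (comm_var s i + rhoc *: (token_err s k - node_err s i)).
Proof.
apply/funext => j; rewrite /comm_var comm_step_node_err /update.
by case: eqP => [->|//]; rewrite addrAC.
Qed.

Lemma comp_step_comm_var s i : comm_var (step s (inr i)) = comm_var s.
Proof.
apply/funext => j; rewrite /comm_var /node_err /grad_err /= /update.
case: eqP => [->|//]; rewrite -!addrA; congr (_ + _).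
by rewrite addrCA -scalerN -scalerDr; congr (_ + _ *: _); rewrite addrA opprB subrK.
Qed.

Lemma imbalance_step s a : imbalance (step s a) = imbalance s.
Proof.
rewrite /imbalance; case: a => [[i k]|i]; last by rewrite comp_step_comm_var.
rewrite comm_step_comm_var comm_step_token_err !sum_update scaleNr.
by rewrite addrACA subrr addr0.
Qed.

(** The right-hand side is the first-order variation of the weighted
    comm_energy.  Its second-order term is (n + K - 1) rhoc^2 |delta|^2, and the
    dual gap decreases by st rhoc (1 - rhoc) |delta|^2, which is enough as
    rhoc <= 1/2 and K <= n. *)
Lemma comm_step_lyap s i k delta : delta = token_err s k - node_err s i ->
  lyap (step s (inl (i, k))) - lyap s <=
  st * rho * (dot (comm_var s i) delta
    - K%:R / n%:R * dot (token_err s k) delta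
    - n%:R^-1 * dot (\sum_j comm_var s j) delta).
Proof.
move=> deltaE.
have := comm_step_node_err s i k; have := comm_step_token_err s i k.
have := comm_step_comm_var s i k; rewrite -deltaE.
move s'E : (step s (inl (i, k))) => s' Ey Eu Ee.
have Ez : node_z s' = node_z s by rewrite -s'E.
have dd : dot delta delta = dot (token_err s k) delta - dot (node_err s i) delta.
  by rewrite -dotNl -dotDl -deltaE.
have D0 := dotxx_ge0 delta.
have ED : comm_energy s' - comm_energy s =
  2 * rhoc * (n%:R * dot (comm_var s i) delta - K%:R * dot (token_err s k) delta
              - dot (\sum_j comm_var s j) delta)
  + (n%:R + K%:R - 1) * rhoc ^+ 2 * dot delta delta.
  rewrite /comm_energy Ey Eu !sum_dotxx_update sum_update dotxxDZ; ring.
have EG : dual_gap s' - dual_gap s = - st * rhoc * (1 - rhoc) * dot delta delta.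
  rewrite /dual_gap Ez Ee Eu !sum_dotxx_update.
  move: dd; move: (dot delta delta) => D ->; field; exact: lt0r_neq0.
have -> : lyap s' - lyap s =
  st ^+ 2 / (n%:R * L) * (comm_energy s' - comm_energy s)
  + 2 * rho * (dual_gap s' - dual_gap s).
  have PB : primal_breg s' = primal_breg s by rewrite /primal_breg Ez.
  rewrite /lyap PB; move: (comm_energy s') (comm_energy s) (dual_gap s') (dual_gap s).
  by move: (primal_breg s) => *; ring.
rewrite ED EG.
move: (dot delta delta) D0 (dot _ delta) (dot _ delta) (dot _ delta) => D D0 a b c.
rewrite -subr_ge0.
set X := (X in 0 <= X).
have -> : X = st * rho * rhoc * D *
    ((4 * n%:R * (1 - rhoc) - (n%:R + K%:R - 1)) / (2 * n%:R)).
  rewrite /X; field; rewrite ?gt_eqF //; lra.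
apply: mulr_ge0.
  apply: mulr_ge0 D0; apply: mulr_ge0; last by rewrite ltW // divr_gt0 // mulr_gt0.
  by rewrite ltW // mulr_gt0.
apply: divr_ge0; last by rewrite mulr_ge0.
have r1 : 0 <= 1 - 2 * rhoc.
  have -> : 1 - 2 * rhoc = st / (L + st) by field; rewrite gt_eqF.
  exact: ltW.
have -> : 4 * n%:R * (1 - rhoc) - (n%:R + K%:R - 1) =
    2 * (n%:R * (1 - 2 * rhoc)) + (n%:R - K%:R) + 1.
  by move: rhoc (n%:R : R) (K%:R : R) => *; ring.
apply: addr_ge0 ler01; apply: addr_ge0; last by rewrite subr_ge0.
by apply: mulr_ge0 => //; apply: mulr_ge0 r1; exact: ltW.
Qed.

(** The right-hand side is the first-order variation of primal_breg.  With z'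
    the new value of z, the second-order term breg z' z is absorbed because
    primal_breg + 2 rho dual_gap has total second-order variation
    - breg z' z - 2 (1 - rho) breg z z' + |grad z' - grad z|^2 / (L + st), where
    1 - rho = L / (L + st) and the last numerator is at most 2 L breg z z'. *)
Lemma comp_step_lyap s i :
  lyap (step s (inr i)) - lyap s
  <= st * rho * dot (grad_err s i) (node_err s i - z_err s i).
Proof.
set s' := step s _; set z := node_z s i; set z' := node_z s' i.
have Ez : z' - z = rho *: (node_err s i - z_err s i).
  rewrite /z' /s' /= updateE rho_compE // /node_err /z_err -/z opprB addrA subrK.
  by rewrite scalerBl scale1r scalerBr addrAC (addrC z) addrK addrC.
set gz := grad (f i) z' - grad (f i) z.
have Et : node_err s' i = node_err s i - st^-1 *: gz.
  rewrite /node_err /gz /z' /s' /= !updateE rho_compE //; by rewrite addrAC.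
have Etn j : j != i -> node_err s' j = node_err s j.
  by move=> ji; rewrite /node_err /s' /= update_neq.
have Ezn j : j != i -> node_z s' j = node_z s j.
  by move=> ji; rewrite /s' /= update_neq.
have EE : comm_energy s' = comm_energy s.
  by rewrite /comm_energy comp_step_comm_var.
have EB : primal_breg s' - primal_breg s = breg (f i) z' ts - breg (f i) z ts.
  rewrite /primal_breg.
  rewrite (sum_change_at (i := i) (G := fun j => breg (f j) (node_z s j) ts)).
    by rewrite -/z' -/z; ring.
  by move=> j ji; rewrite Ezn.
have EG : dual_gap s' - dual_gap s =
  st / 2 * (dot (node_err s' i) (node_err s' i) - dot (node_err s i) (node_err s i))
  + (breg (f i) ts z' - breg (f i) ts z).
  rewrite /dual_gap.
  rewrite (sum_change_at (F := fun j => breg (f j) ts (node_z s' j))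
    (i := i) (G := fun j => breg (f j) ts (node_z s j))); last first.
    by move=> j ji; rewrite Ezn.
  rewrite -/z' -/z.
  rewrite (sum_change_at (F := fun j => dot (node_err s' j) (node_err s' j))
    (i := i) (G := fun j => dot (node_err s j) (node_err s j))); last first.
    by move=> j ji; rewrite Etn.
  rewrite -/z' -/z; ring.
have -> : lyap s' - lyap s = (primal_breg s' - primal_breg s)
    + 2 * rho * (dual_gap s' - dual_gap s).
  rewrite /lyap EE; ring.
rewrite EB EG breg_three_points breg_three_points_dual Et -scaleNr dotxxDZ -/gz.
have gE : dot (grad (f i) z - grad (f i) ts) (z' - z) =
    st * rho * dot (grad_err s i) (node_err s i - z_err s i).
  rewrite Ez dotZr /grad_err dotZl -/z; field; by rewrite !gt_eqF.
(* By symmetrization, as z' - z is rho (e - w): this turns the first-order part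
   of the dual gap into divergences. *)
have vE : breg (f i) z' z + breg (f i) z z' =
    rho * (dot (node_err s i) gz - dot gz (z - ts)).
  by rewrite breg_sym -/gz Ez dotZr [dot gz _]dotDr dotNr (dotC gz (node_err s i)).
have gzb : dot gz gz <= 2 * L * breg (f i) z z'.
  apply: le_trans (breg_ge_grad z z' L0 (fL i)).
  by rewrite /gz -opprB dotNl dotNr opprK.
have /andP[P0 _] := breg_bounds z' z (fL i).
rewrite gE -subr_ge0; move: vE gzb P0.
move: (breg _ z z') (breg _ z' z) (dot gz gz) (dot gz (z - ts))
  (dot (node_err s i) gz) (dot (grad_err s i) _).
move=> Q P m a b c vE gzb P0; set X := (X in 0 <= X).
have -> : X = ((L + st) * P + (2 * L * Q - m)) / (L + st).
  have PE : P = rho * (b - a) - Q by rewrite -vE addrK.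
  rewrite /X PE; field; by rewrite !gt_eqF.
apply: divr_ge0; last exact: ltW.
apply: addr_ge0; last by rewrite subr_ge0.
by apply: mulr_ge0 P0; exact: ltW.
Qed.

(** Summing delta over all edges applies the Laplacian to (e, u), and
    comm_energy is built on its pseudo-inverse; on zero-sum vectors the two
    cancel and leave the plain inner product of (y, u) with (e, u). *)
Lemma sum_comm_steps s : imbalance s = 0 ->
  \sum_i \sum_k (lyap (step s (inl (i, k))) - lyap s) <=
  - (K%:R * st * rho) * (\sum_i dot (comm_var s i) (node_err s i)
                        + \sum_k dot (token_err s k) (token_err s k)).
Proof.
move=> bal.
apply: le_trans (ler_sum _ (fun i _ => ler_sum _ (fun k _ =>
  comm_step_lyap (erefl (token_err s k - node_err s i))))) _.
pose Y := \sum_i comm_var s i; pose E := \sum_i node_err s i.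
have UE : \sum_k token_err s k = - Y.
  by apply/eqP; rewrite -addr_eq0 addrC -/(imbalance s) bal.
have S1 : \sum_i \sum_k dot (comm_var s i) (token_err s k - node_err s i) =
    - dot Y Y - K%:R * \sum_i dot (comm_var s i) (node_err s i).
  rewrite -dotNr -UE /Y dot_suml mulr_sumr -sumrB; apply: eq_bigr => i _.
  by rewrite -dot_sumr sumrB sumr_const card_ord -scaler_nat dotDr dotNr dotZr.
have S2 : \sum_i \sum_k dot (token_err s k) (token_err s k - node_err s i) =
    n%:R * \sum_k dot (token_err s k) (token_err s k) + dot Y E.
  rewrite exchange_big /= -(opprK (dot Y E)) -dotNl -UE dot_suml mulr_sumr -sumrB.
  apply: eq_bigr => k _.
  by rewrite -dot_sumr sumrB sumr_const card_ord -scaler_nat dotDr dotNr dotZr.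
have S3 : \sum_i \sum_k dot Y (token_err s k - node_err s i) =
    - (n%:R * dot Y Y) - K%:R * dot Y E.
  have -> : \sum_i \sum_k dot Y (token_err s k - node_err s i)
      = \sum_(i < n) (- dot Y Y - K%:R * dot Y (node_err s i)).
    apply: eq_bigr => i _; rewrite -dot_sumr sumrB sumr_const card_ord -scaler_nat.
    by rewrite UE dotDr !dotNr dotZr.
  rewrite sumrB sumr_const card_ord -mulr_sumr -dot_sumr mulNrn.
  by rewrite (mulr_natl (dot Y Y)).
rewrite le_eqVlt; apply/orP; left; apply/eqP.
under eq_bigr do rewrite -mulr_sumr !sumrB -!mulr_sumr.
rewrite -mulr_sumr !sumrB -!mulr_sumr S1 S2 S3.
move: (dot Y Y) (dot Y E) (\sum_i _) (\sum_k _) rho => a b c e r.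
by field; rewrite gt_eqF.
Qed.

Lemma sum_comp_steps s :
  \sum_i (lyap (step s (inr i)) - lyap s) <=
  st * rho * (\sum_i dot (grad_err s i) (node_err s i)
              - \sum_i dot (grad_err s i) (z_err s i)).
Proof.
apply: le_trans (ler_sum _ (fun i _ => comp_step_lyap s i)) _.
rewrite le_eqVlt -mulr_sumr -sumrB; apply/orP; left; apply/eqP.
by congr (_ * _); apply: eq_bigr => i _; rewrite dotDr dotNr.
Qed.

(** The terms <g_i, e_i>, negative for communication steps since y = e + g and
    positive for computation steps, cancel out. *)
Lemma mean_lyap_step s : imbalance s = 0 ->
  \sum_a draw_prob (1 / 2) (1 / 2) a * lyap (step s a)
  <= lyap s - st * rho / (2 * n%:R) * dissipation s.
Proof.
move=> bal.
rewrite big_sumType /=.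
have -> : \sum_p 1 / 2 / (n%:R * K%:R) * lyap (step s (inl p)) =
    1 / 2 / (n%:R * K%:R) * \sum_i \sum_k lyap (step s (inl (i, k))).
  by rewrite pair_bigA -mulr_sumr; congr (_ * _); apply: eq_bigr => -[].
have := sum_comm_steps bal; have := sum_comp_steps s.
rewrite sumrB sumr_const card_ord.
have -> : \sum_i \sum_k (lyap (step s (inl (i, k))) - lyap s) =
  \sum_i \sum_k lyap (step s (inl (i, k))) - n%:R * K%:R * lyap s.
  under eq_bigr do rewrite sumrB sumr_const card_ord.
  by rewrite sumrB sumr_const card_ord -mulrnA mulnC -natrM mulr_natl.
rewrite -mulr_sumr /dissipation.
have -> : \sum_i dot (comm_var s i) (node_err s i) =
    \sum_i dot (node_err s i) (node_err s i) + \sum_i dot (grad_err s i) (node_err s i).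
  by rewrite -big_split; apply: eq_bigr => i _; rewrite dotDl.
move: (\sum_i dot (grad_err s i) (z_err s i)) (\sum_k dot (token_err s k) _).
move: (\sum_i dot (node_err s i) _) (\sum_i dot (grad_err s i) _) (lyap s) => EE GE V GW UU.
move: (\sum_i lyap _) (\sum_i \sum_k lyap _) rho => A B r.
rewrite -(mulr_natl V) !lerBlDr => hA hB.
have -> : V - st * r / (2 * n%:R) * (EE + UU + GW) =
  1 / 2 / (n%:R * K%:R) * (- (K%:R * st * r) * (EE + GE + UU) + n%:R * K%:R * V)
  + 1 / 2 / n%:R * (st * r * (GE - GW) + n%:R * V).
  by field; rewrite !gt_eqF.
by apply: lerD; rewrite ler_pM2l // !divr_gt0 ?mulr_gt0.
Qed.

Lemma dot_grad_err s i : st * dot (grad_err s i) (z_err s i) =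
  breg (f i) (node_z s i) ts + breg (f i) ts (node_z s i).
Proof.
by rewrite breg_sym /grad_err dotZl mulrA divff ?mul1r // gt_eqF.
Qed.

Lemma grad_err_cocoercive s i :
  st ^+ 2 * dot (grad_err s i) (grad_err s i)
  <= L * (st * dot (grad_err s i) (z_err s i)).
Proof.
have := cocoercive (node_z s i) ts L0 (fL i).
rewrite dot_grad_err breg_sym; apply: le_trans.
rewrite /grad_err dotZl dotZr; move: (dot _ _) => m.
by rewrite le_eqVlt; apply/orP; left; apply/eqP; field; rewrite gt_eqF.
Qed.

Let primal_breg_ge0 s : 0 <= primal_breg s.
Proof. by apply: sumr_ge0 => i _; have /andP[] := breg_bounds (node_z s i) ts (fL i). Qed.

Let dual_breg_ge0 s : 0 <= \sum_i breg (f i) ts (node_z s i).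
Proof. by apply: sumr_ge0 => i _; have /andP[] := breg_bounds ts (node_z s i) (fL i). Qed.

Let sum_dotxx_ge0 (I : finType) (u : I -> 'rV[R]_d) : 0 <= \sum_i dot (u i) (u i).
Proof. by apply: sumr_ge0 => i _; exact: dotxx_ge0. Qed.

Lemma dual_gap_ge0 s : 0 <= dual_gap s.
Proof.
apply: addr_ge0 => //; apply: mulr_ge0; last exact: addr_ge0.
by rewrite divr_ge0 // ltW.
Qed.

(** The two divergences of z_i and ts add up to st <g_i, w_i>. *)
Lemma dual_gap_le s : primal_breg s + dual_gap s <= st * dissipation s.
Proof.
have := sum_dotxx_ge0 (node_err s); have := sum_dotxx_ge0 (token_err s).
have : st * (\sum_i dot (grad_err s i) (z_err s i)) =
    primal_breg s + \sum_i breg (f i) ts (node_z s i).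
  rewrite mulr_sumr -big_split; apply: eq_bigr => i _; exact: dot_grad_err.
rewrite /dissipation /dual_gap [st * (_ + _)]mulrDr => ->.
move: (primal_breg s) (\sum_i breg _ _ _) (\sum_i _) (\sum_k _) => a b c e h1 h2.
have := mulr_ge0 (ltW s0) (addr_ge0 h1 h2).
move: (st) => t; lra.
Qed.

(** Bounding y by e and g leaves sum |g|^2, controlled by cocoercivity of the
    gradients: st |g_i|^2 <= L <g_i, w_i>. *)
Lemma comm_energy_le s :
  st ^+ 2 / (n%:R * L) * comm_energy s <= (2 + 2 * st / L) * (st * dissipation s).
Proof.
have UU0 := sum_dotxx_ge0 (token_err s).
have EE0 := sum_dotxx_ge0 (node_err s).
have YY : \sum_i dot (comm_var s i) (comm_var s i) <=
    2 * \sum_i dot (node_err s i) (node_err s i)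
    + 2 * \sum_i dot (grad_err s i) (grad_err s i).
  by rewrite !mulr_sumr -big_split; apply: ler_sum => i _; exact: dotxxD_le.
have GG : st ^+ 2 * (\sum_i dot (grad_err s i) (grad_err s i)) <=
    L * (st * \sum_i dot (grad_err s i) (z_err s i)).
  by rewrite !mulr_sumr; apply: ler_sum => i _; exact: grad_err_cocoercive.
have GW0 : 0 <= st * \sum_i dot (grad_err s i) (z_err s i).
  rewrite -(pmulr_rge0 _ L0); apply: le_trans GG; apply: mulr_ge0 => //.
  by rewrite exprn_ge0 // ltW.
have := dotxx_ge0 (\sum_i comm_var s i); rewrite /comm_energy /dissipation.
move: YY GG GW0 UU0 EE0; move: (\sum_i dot (comm_var s i) _) (dot _ _) => YY SS.
move: (\sum_i dot (node_err s i) _) (\sum_k dot (token_err s k) _) => EE UU.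
move: (\sum_i dot (grad_err s i) (grad_err s i)).
move=> GG; move: (\sum_i dot (grad_err s i) _) => GW hY hG GW0 UU0 EE0 SS0.
have bound : n%:R * YY + K%:R * UU - SS <= n%:R * (2 * EE + 2 * GG + UU).
  have := ler_wpM2l (ltW N0) hY; have := ler_wpM2r UU0 kN.
  move: (n%:R : R) (K%:R : R) => N k h1 h2; lra.
have c0 : 0 <= st ^+ 2 / (n%:R * L) by rewrite divr_ge0 ?exprn_ge0 ?mulr_ge0 // ltW.
apply: le_trans (ler_wpM2l c0 bound) _.
have -> : st ^+ 2 / (n%:R * L) * (n%:R * (2 * EE + 2 * GG + UU)) =
    st ^+ 2 / L * (2 * EE + UU) + 2 / L * (st ^+ 2 * GG).
  by field; rewrite !gt_eqF.
have L20 : 0 <= 2 / L by rewrite divr_ge0 // ltW.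
apply: le_trans (lerD (lexx _) (ler_wpM2l L20 hG)) _.
rewrite -subr_ge0; set X := (X in 0 <= X).
have -> : X = 2 * st * (EE + UU) + st ^+ 2 / L * UU + 2 * st / L * (st * GW).
  by rewrite /X; field; rewrite gt_eqF.
apply: addr_ge0; first apply: addr_ge0.
- apply: mulr_ge0; last exact: addr_ge0.
  by apply: mulr_ge0 => //; exact: ltW.
- apply: mulr_ge0 => //; apply: divr_ge0; last exact: ltW.
  by apply: exprn_ge0; exact: ltW.
- apply: mulr_ge0 => //; apply: divr_ge0; last exact: ltW.
  by apply: mulr_ge0 => //; exact: ltW.
Qed.

Lemma lyap_le_dissipation s : lyap s <= (5 + 2 * st / L) * (st * dissipation s).
Proof.
have rho1 : rho <= 1 by rewrite ler_pdivrMr // mul1r lerDr ltW.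
have rG : rho * dual_gap s <= dual_gap s by rewrite ler_piMl // dual_gap_ge0.
have := comm_energy_le s; have := dual_gap_le s; have := primal_breg_ge0 s.
have := dual_gap_ge0 s; rewrite /lyap -(mulrA 2 rho); move: rG.
rewrite (_ : 5 + 2 * st / L = (2 + 2 * st / L) + 3); last by ring.
rewrite (mulrDl _ 3); move: (st ^+ 2 / (n%:R * L) * _) (_ * (st * dissipation s)).
move: (dissipation s) => D; move: (st * D) => X1.
move: (rho * dual_gap s) (dual_gap s) (primal_breg s).
by move=> r G P C X h1 h2 h3 h4 h5; lra.
Qed.

(** By Cauchy-Schwarz, as the sum of all |y_i - y_j|^2 is nonnegative. *)
Lemma comm_energy_ge0 s : 0 <= comm_energy s.
Proof.
have : 0 <= \sum_i \sum_j dot (comm_var s i - comm_var s j) (comm_var s i - comm_var s j).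
  by apply: sumr_ge0 => i _; apply: sum_dotxx_ge0.
set Y := fun i => dot (comm_var s i) (comm_var s i).
have -> : \sum_i \sum_j dot (comm_var s i - comm_var s j) (comm_var s i - comm_var s j)
  = \sum_i (n%:R * Y i + \sum_j Y j - 2 * dot (comm_var s i) (\sum_j comm_var s j)).
  apply: eq_bigr => i _; rewrite dot_sumr [2 * _]mulr_sumr.
  have -> : n%:R * Y i = \sum_(j < n) Y i by rewrite sumr_const card_ord mulr_natl.
  rewrite -big_split -sumrB; apply: eq_bigr => j _.
  by rewrite dotxxB.
rewrite sumrB big_split /= -!mulr_sumr -dot_suml sumr_const card_ord.
rewrite -(mulr_natl (\sum_j Y j)) /comm_energy => h.
have := mulr_ge0 (ltW k0) (sum_dotxx_ge0 (token_err s)).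
move: h; rewrite -/Y; move: (n%:R * _) (K%:R * _) (dot _ _) => a b c; lra.
Qed.

Lemma token_err_le_lyap s k :
  st * rho * dot (token_err s k) (token_err s k) <= lyap s.
Proof.
have h1 : 0 <= st ^+ 2 / (n%:R * L) * comm_energy s.
  apply: mulr_ge0 (comm_energy_ge0 s).
  by rewrite divr_ge0 ?exprn_ge0 ?mulr_ge0 // ltW.
have h2 : st / 2 * dot (token_err s k) (token_err s k) <= dual_gap s.
  rewrite /dual_gap -[X in X <= _]addr0; apply: lerD => //.
  apply: ler_wpM2l; first by rewrite divr_ge0 // ltW.
  rewrite -[X in X <= _]add0r; apply: lerD => //.
  rewrite (bigD1 k) //= lerDl; apply: sumr_ge0 => j _; exact: dotxx_ge0.
have := ler_wpM2l (mulr_ge0 (ler0n _ 2) (ltW rho_gt0) : 0 <= 2 * rho) h2.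
have -> : 2 * rho * (st / 2 * dot (token_err s k) (token_err s k))
   = st * rho * dot (token_err s k) (token_err s k).
  by move: rho (dot _ _) => *; field.
move=> /le_trans; apply; rewrite /lyap.
by rewrite lerDr addr_ge0.
Qed.

Lemma mean_lyap_contracts s : imbalance s = 0 ->
  \sum_a draw_prob (1 / 2) (1 / 2) a * lyap (step s a)
  <= (1 - rho / (2 * n%:R * (5 + 2 * st / L))) * lyap s.
Proof.
move=> /mean_lyap_step /le_trans; apply.
have c0 : 0 < 5 + 2 * st / L by rewrite addr_gt0 // divr_gt0 // mulr_gt0.
rewrite mulrBl mul1r lerD2l lerN2.
have -> : st * rho / (2 * n%:R) * dissipation s =
   rho / (2 * n%:R * (5 + 2 * st / L)) * ((5 + 2 * st / L) * (st * dissipation s)).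
  move: (5 + _) c0 rho (dissipation s) => c c0 r D.
  by field; rewrite !gt_eqF.
apply: ler_wpM2l (lyap_le_dissipation s).
by rewrite ltW // divr_gt0 // !mulr_gt0.
Qed.

(** Each token starts at 0 and each node at - grad f_i (z_i) / st, so the
    imbalance is - (n + K) ts - sum grad f_i ts / st, whatever z0 is. *)
Lemma imbalance_init z0 :
  is_minimizer (regularized_objective f sigma) ts ->
  imbalance (@tgd_init R n d K f sigma z0) = 0.
Proof.
move=> /(minimizer_stationary L0 sigma0 fL) opt; rewrite /imbalance.
have -> : \sum_k token_err (@tgd_init R n d K f sigma z0) k = - (K%:R *: ts).
  by rewrite /token_err /= sumrB sumr_const mul0rn sumr_const card_ord sub0r scaler_nat.
have -> : \sum_i comm_var (@tgd_init R n d K f sigma z0) i =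
    \sum_i (- ts - st^-1 *: grad (f i) ts).
  apply: eq_bigr => i _; rewrite /comm_var /node_err /grad_err /=.
  by rewrite scalerBr addrACA addNr add0r.
rewrite sumrB sumr_const card_ord mulNrn -(scaler_nat n ts) -scaler_sumr.
rewrite (eqP (_ : \sum_i grad (f i) ts == - ((n%:R * sigma) *: ts))); last first.
  by rewrite -addr_eq0 opt.
rewrite scalerN opprK scalerA -!scaleNr -!scalerDl.
rewrite (_ : _ + _ = 0) ?scale0r // /sigma_tilde.
field; rewrite !gt_eqF //= addr_gt0 //.
Qed.

End Lyapunov.

(** * Expectations over finite sequences of draws *)

Section TupleSums.
Context {R : realType} {A : finType}.
Variable q : A -> R.

(** Expectation of psi over m independent draws of law q.  It is a function of
    sequences, so that it can be unfolded from the head. *)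
Definition tuple_mean m (psi : seq A -> R) : R :=
  \sum_(s : m.-tuple A) (\prod_(a <- s) q a) * psi s.

Lemma tuple_mean0 psi : tuple_mean 0 psi = psi [::].
Proof.
rewrite /tuple_mean (big_pred1 [tuple]) => [|s]; last by rewrite [s]tuple0 /= eqxx.
by rewrite big_nil mul1r.
Qed.

Lemma tuple_meanS m psi :
  tuple_mean m.+1 psi = \sum_a q a * tuple_mean m (fun s => psi (a :: s)).
Proof.
rewrite /tuple_mean.
under [RHS]eq_bigr do rewrite mulr_sumr.
rewrite pair_bigA /= (reindex (fun p : A * m.-tuple A => cons_tuple p.1 p.2)) /=.
  by apply: eq_bigr => -[a s] _ /=; rewrite big_cons mulrA.
exists (fun s => (thead s, behead_tuple s)) => [[a s] _|s _] /=.
  by congr pair; apply: val_inj.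
by rewrite [RHS]tuple_eta; apply: val_inj.
Qed.

Lemma eq_tuple_mean m psi psi' : (forall s, psi s = psi' s) ->
  tuple_mean m psi = tuple_mean m psi'.
Proof. by move=> e; apply: eq_bigr => s _; rewrite e. Qed.

Hypothesis q_ge0 : forall a, 0 <= q a.

(** A function V contracted on average by one random step, from every state in
    an invariant set, decays geometrically along the random walk.  The first
    draw is split off, so that the induction hypothesis applies from the next
    state. *)
Lemma tuple_mean_foldl (S : Type) (step : S -> A -> S) (inv : S -> Prop)
    (V : S -> R) (c : R) :
  0 <= c -> (forall s a, inv s -> inv (step s a)) ->
  (forall s, inv s -> \sum_a q a * V (step s a) <= c * V s) ->
  forall m s, inv s -> tuple_mean m (fun l => V (foldl step s l)) <= c ^+ m * V s.
Proof.
move=> c0 inv_step contr; elim=> [|m IH] s sP.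
  by rewrite tuple_mean0 expr0 mul1r.
rewrite tuple_meanS /=.
apply: (@le_trans _ _ (\sum_a q a * (c ^+ m * V (step s a)))).
  by apply: ler_sum => a _; apply: ler_wpM2l => //; exact/IH/inv_step.
under eq_bigr do rewrite mulrCA.
rewrite -mulr_sumr exprSr -mulrA; apply: ler_wpM2l; first exact: exprn_ge0.
exact: contr.
Qed.

Hypothesis q_sum1 : \sum_a q a = 1.

Lemma tuple_meanD_cst m c psi :
  tuple_mean m (fun s => c + psi s) = c + tuple_mean m psi.
Proof.
elim: m psi => [|m IH] psi; first by rewrite !tuple_mean0.
rewrite !tuple_meanS; under eq_bigr do rewrite IH mulrDr.
by rewrite big_split -mulr_suml q_sum1 mul1r.
Qed.

Lemma tuple_mean_sum m (h : A -> R) :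
  tuple_mean m (fun s => \sum_(a <- s) h a) = m%:R * \sum_a q a * h a.
Proof.
elim: m => [|m IH]; first by rewrite tuple_mean0 big_nil mul0r.
rewrite tuple_meanS.
under eq_bigr => a _ do
  rewrite (eq_tuple_mean _ (fun s => big_cons _ _ a s xpredT h)) tuple_meanD_cst IH mulrDr.
by rewrite big_split -mulr_suml q_sum1 mul1r -natr1 mulrDl mul1r addrC.
Qed.

End TupleSums.

Section Draws.
Context {R : realType} {n K : nat} {disp : measure_display}.
Context {Omega : measurableType disp} (P : probability Omega R).
Variables (p_comm p_comp : R) (xi : nat -> Omega -> draw n K).
Hypothesis xiP : iid_draws P p_comm p_comp xi.

Local Notation q := (@draw_prob R n K p_comm p_comp).

(** The random variable is a finite combination of indicators of the events
    that fix the draws at the times in I, and those have product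
    probability. *)
Lemma expectation_draws (a0 : draw n K) (psi : seq (draw n K) -> R) (I : seq nat) :
  uniq I -> (forall s, 0 <= psi s) ->
  ('E_P[fun w => psi (map (xi ^~ w) I)] = (tuple_mean q (size I) psi)%:E)%E.
Proof.
move=> uI psi0; case: xiP => mxi indep.
(* The default a0 is never read at times in I. *)
pose path (s : seq (draw n K)) t := nth a0 s (index t I).
have pathK (s : (size I).-tuple (draw n K)) : map (path s) I = s.
  apply: (@eq_from_nth _ a0); first by rewrite size_map size_tuple.
  move=> j; rewrite size_map => jI.
  by rewrite (nth_map 0%N) // /path index_uniq.
pose ev (s : (size I).-tuple (draw n K)) :=
  \bigcap_(t in [set` I]) [set w | xi t w = path s t].
have mev s : measurable (ev s).
  by apply: fin_bigcap_measurable => // t _; exact: mxi.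
have Pev s : P (ev s) = (\prod_(a <- s) q a)%:E.
  by rewrite /ev indep // -[in RHS](pathK s) big_map.
have evE s w : (\1_(ev s) w : R) = (map (xi ^~ w) I == s)%:R.
  rewrite indicE; congr (nat_of_bool _)%:R; apply/idP/eqP.
    rewrite inE => sw; rewrite -(pathK s); apply/eq_in_map => t tI; exact: sw.
  move=> sw; rewrite inE => t tI; rewrite /= /path -sw.
  by rewrite (nth_map 0%N) ?index_mem // nth_index.
rewrite unlock.
under eq_integral => w _.
  rewrite (_ : psi _ = \sum_(s : (size I).-tuple (draw n K)) psi s * \1_(ev s) w); last first.
    rewrite (bigD1 (map_tuple (xi ^~ w) (in_tuple I))) //= evE eqxx mulr1 big1 ?addr0 //.
    by move=> s /negPf ne; rewrite evE eq_sym [_ == _]ne mulr0.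
  rewrite -sumEFin.
  over.
rewrite ge0_integral_sum //=.
- rewrite /tuple_mean -sumEFin; apply: eq_bigr => s _.
  under eq_integral do rewrite EFinM.
  rewrite ge0_integralZl_EFin //=.
  + by rewrite integral_indic // setIT [X in (_ * X)%E](Pev s) -EFinM mulrC.
  + by apply/measurable_EFinP; exact: measurable_indic.
- move=> s; apply/measurable_EFinP; apply: measurable_funM.
    exact: measurable_cst.
  exact: measurable_indic.
- by move=> s w _; rewrite lee_fin mulr_ge0.
Qed.

Lemma expectation_count (a0 : draw n K) (h : draw n K -> R) (T : nat) :
  (forall a, 0 <= h a) -> \sum_a q a = 1 ->
  ('E_P[fun w => (\sum_(t < T) h (xi t w))%R] = (T%:R * \sum_a q a * h a)%:E)%E.
Proof.
move=> h0 q1; rewrite -(tuple_mean_sum q1) -[in RHS](size_iota 0 T).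
rewrite -(expectation_draws a0) ?iota_uniq // => [|s]; last exact: sumr_ge0.
congr (expectation P _); apply/funext => w.
by rewrite big_map -/(index_iota 0 T) -[T in RHS]subn0 big_mkord.
Qed.

End Draws.

Lemma tgd_foldl (R : realType) (n d K : nat) (f : 'I_n -> 'rV[R]_d -> R)
    (L sigma p_comm p_comp : R) z0 (a : nat -> draw n K) t :
  tgd f L sigma p_comm p_comp z0 a t =
  foldl (tgd_step f L sigma p_comm p_comp) (tgd_init K f sigma z0)
    (map a (iota 0 t)).
Proof.
by elim: t => [|t IH] //; rewrite -[in RHS]addn1 iotaD map_cat foldl_cat /= -IH.
Qed.

(** * Number of iterations *)

Section Rates.
Context {R : realType}.

Lemma sum_draw_prob (n K : nat) : (0 < n)%N -> (0 < K)%N ->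
  \sum_(a : draw n K) draw_prob (1 / 2) (1 / 2) a = 1 :> R.
Proof.
move=> n0 K0; rewrite big_sumType /= !sumr_const card_prod !card_ord.
rewrite -(mulr_natl _ (n * K)) -(mulr_natl _ n) natrM.
by field; rewrite !pnatr_eq0 -!lt0n n0 K0.
Qed.

(** (1 - 1/r)^t <= exp (- t/r), so any t >= r ln (C1/eps) will do.  The factor
    e in the logarithm pays for rounding up: it adds r >= 1 to the budget as
    soon as eps < C1, and T = 0 serves otherwise. *)
Lemma geometric_stopping_time (C1 r eps : R) : 0 < C1 -> 1 <= r -> 0 < eps ->
  exists T : nat,
    (forall t, (T <= t)%N -> C1 * (1 - r^-1) ^+ t <= eps) /\
    T%:R <= r * Num.max 0 (ln (expR 1 * C1 / eps)).
Proof.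
move=> C0 r1 e0; have r0 : 0 < r by apply: lt_le_trans r1.
have q0 : 0 <= 1 - r^-1 by rewrite subr_ge0 invf_le1.
have q1 : 1 - r^-1 <= 1 by rewrite gerBl invr_ge0 ltW.
have [le_C1|lt_C1] := leP C1 eps.
  exists 0%N; split; last by rewrite mulr_ge0 ?le_max ?lexx // ltW.
  move=> t _; apply: le_trans le_C1; rewrite ger_pMr //; exact: exprn_ile1.
have l0 : 0 < ln (C1 / eps) by rewrite ln_gt0 // ltr_pdivlMr // mul1r.
have x0 : 0 <= r * ln (C1 / eps) by rewrite mulr_ge0 ?ltW.
exists (Num.truncn (r * ln (C1 / eps))).+1; have /andP[lo hi] := truncn_itv x0.
split=> [t Tt|].
  have rt : ln (C1 / eps) <= t%:R / r.
    rewrite ler_pdivlMr // mulrC; apply: le_trans (ltW hi) _.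
    by rewrite ler_nat.
  have /lerXn2r : (1 - r^-1) <= expR (- r^-1) by exact: expR_ge1Dx.
  move=> /(_ t q0 (expR_ge0 _)); rewrite -expRM_natl mulrN expRN => h.
  have : expR (ln (C1 / eps)) <= expR (t%:R / r) by rewrite ler_expR.
  rewrite lnK ?posrE ?divr_gt0 // ler_pdivrMr // => hC.
  apply: le_trans (ler_wpM2l (ltW C0) h) _.
  by rewrite ler_pdivrMr ?expR_gt0 // mulrC.
have -> : ln (expR 1 * C1 / eps) = 1 + ln (C1 / eps).
  by rewrite -mulrA lnM ?posrE ?expR_gt0 ?divr_gt0 // expRK.
rewrite max_r; last by rewrite addr_ge0 // ltW.
by rewrite mulrDr mulr1 -natr1 addrC lerD.
Qed.

End Rates.

(** * Convergence rate and expected costs *)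

Section Convergence.
Context {R : realType} {n d K : nat}.
Variables (f : 'I_n -> 'rV[R]_d -> R) (L sigma kappa0 : R) (ts : 'rV[R]_d).
Variable z0 : 'I_n -> 'rV[R]_d.
Hypotheses (L0 : 0 < L) (sigma0 : 0 < sigma).
Hypothesis fL : forall i, local_function L (f i).
Hypothesis ts_min : is_minimizer (regularized_objective f sigma) ts.
Hypotheses (kappa0_gt1 : 1 < kappa0) (kappa0_le : kappa0 <= 1 + L / sigma).
Hypothesis K_range : (1 <= K <= n)%N.

Let K0 : (0 < K)%N. Proof. by case/andP: K_range. Qed.
Let Kn : (K <= n)%N. Proof. by case/andP: K_range. Qed.
Let n0 : (0 < n)%N. Proof. exact: leq_trans Kn. Qed.

Local Notation st := (@sigma_tilde R n K sigma).
Local Notation rho := (st / (L + st)).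
Local Notation kappa := (1 + L / sigma).

(** Four times the value of 5 + 2 st/L at its largest, st/L = 1/(kappa0 - 1):
    one factor 2 is the probability 1/2 of each kind of step, the other is the
    loss in rho >= 1/(2 kappa). *)
Definition rate_constant : R := 4 * (5 + 2 / (kappa0 - 1)).

Lemma rate_constant_ge1 : 1 <= rate_constant.
Proof.
have : 0 <= 2 / (kappa0 - 1) by rewrite divr_ge0 // subr_ge0 ltW.
rewrite /rate_constant; move: (2 / _) => a; lra.
Qed.

Lemma sigma_tilde_bounds : sigma / 2 <= st <= sigma.
Proof.
have N0 : 0 < n%:R :> R by rewrite ltr0n.
have k0 : 0 < K%:R :> R by rewrite ltr0n.
have kN : K%:R <= n%:R :> R by rewrite ler_nat.
rewrite /sigma_tilde mulrAC.
move: (n%:R : R) (K%:R : R) N0 k0 kN => N k N0 k0 kN.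
have hN := ler_wpM2l (ltW sigma0) kN; have hk := mulr_gt0 sigma0 k0.
apply/andP; split; [rewrite ler_pdivlMr|rewrite ler_pdivrMr]; rewrite ?addr_gt0 //.
  lra.
lra.
Qed.

(** Replaces the rate by one that does not depend on K: 2 kappa rho >= 1 since
    st >= sigma/2, and st/L <= 1/(kappa0 - 1) since st <= sigma. *)
Lemma contraction_le :
  1 - rho / (2 * n%:R * (5 + 2 * st / L)) <= 1 - (n%:R * kappa * rate_constant)^-1.
Proof.
have N0 : 0 < n%:R :> R by rewrite ltr0n.
have s0 := sigma_tilde_gt0 sigma0 n0 K0.
have /andP[lo hi] := sigma_tilde_bounds.
have A0 : 0 < rate_constant by apply: lt_le_trans rate_constant_ge1.
have kap0 : 0 < kappa by rewrite addr_gt0 // divr_gt0.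
have c0 : 0 < 5 + 2 * st / L by rewrite addr_gt0 // divr_gt0 // mulr_gt0.
have rhoP : 1 <= 2 * kappa * rho.
  have hL : L <= L / sigma * (2 * st).
    rewrite -{1}(divfK (lt0r_neq0 sigma0) L); apply: ler_wpM2l.
      by rewrite divr_ge0 // ltW.
    by move: st lo => t; lra.
  rewrite mulrA ler_pdivlMr ?addr_gt0 // mul1r.
  by move: (L / sigma) st hL s0 => a t; lra.
have stP : 5 + 2 * st / L <= rate_constant / 4.
  rewrite /rate_constant [4 * _]mulrC mulfK // lerD2l -mulrA ler_wpM2l //.
  have k1 : 0 < kappa0 - 1 by rewrite subr_gt0.
  rewrite ler_pdivrMr // ler_pdivlMl //.
  apply: le_trans (ler_wpM2l (ltW k1) hi) _.
  by rewrite -ler_pdivlMr // lerBlDl.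
rewrite lerD2l lerN2.
have -> : (n%:R * kappa * rate_constant)^-1 =
    (2 * kappa)^-1 / (2 * n%:R * (rate_constant / 4)).
  by move: kappa kap0 rate_constant A0 => a ha b hb; field; rewrite !gt_eqF.
have A4 : 0 < rate_constant / 4 by rewrite divr_gt0.
move: (rate_constant / 4) A4 stP => A4 A40 stP.
apply: ler_pM.
- by rewrite invr_ge0 mulr_ge0 // ltW.
- by rewrite invr_ge0 ltW // !mulr_gt0.
- by rewrite -[X in X <= _]mulr1 ler_pdivrMl ?mulr_gt0.
- by rewrite lef_pV2 ?posrE ?mulr_gt0 // ler_pM2l // mulr_gt0.
Qed.

Lemma expected_token_error (disp : measure_display) (Omega : measurableType disp)
    (P : probability Omega R) (xi : nat -> Omega -> draw n K) t k :
  iid_draws P (1 / 2) (1 / 2) xi ->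
  ('E_P[fun w => sqnorm (token_theta
       (tgd f L sigma (1 / 2) (1 / 2) z0 (xi ^~ w) t) k - ts)]
   <= (`|lyap f L sigma ts (tgd_init K f sigma z0) / (st * rho)|
       * (1 - (n%:R * kappa * rate_constant)^-1) ^+ t)%:E)%E.
Proof.
move=> xiP.
have s0 := sigma_tilde_gt0 sigma0 n0 K0.
have sr0 : 0 < st * rho by rewrite mulr_gt0 // divr_gt0 // addr_gt0.
have r1 : 1 <= n%:R * kappa * rate_constant.
  have := rate_constant_ge1; have : 1 <= n%:R :> R by rewrite ler1n.
  have : 1 <= kappa by rewrite lerDl divr_ge0 // ltW.
  move: (n%:R : R) kappa rate_constant => N k' A h1 h2 h3.
  by rewrite mulr_ege1 // mulr_ege1.
have q0 : 0 <= 1 - (n%:R * kappa * rate_constant)^-1 :> R.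
  by rewrite subr_ge0 invf_le1 // (lt_le_trans _ r1).
pose err (s : @tgd_state R n d K) := sqnorm (token_theta s k - ts).
have err_ge0 s : 0 <= err s by rewrite /err sqnormE dotxx_ge0.
pose walk := foldl (tgd_step f L sigma (1 / 2) (1 / 2)) (tgd_init K f sigma z0).
have -> : (fun w => sqnorm (token_theta
    (tgd f L sigma (1 / 2) (1 / 2) z0 (xi ^~ w) t) k - ts)) =
    (fun w => err (walk (map (xi ^~ w) (iota 0 t)))).
  by apply/funext => w; rewrite tgd_foldl.
rewrite (expectation_draws xiP (inr (Ordinal n0)) (psi := err \o walk)) ?iota_uniq //;
  last first.
  by move=> l; exact: err_ge0.
rewrite size_iota lee_fin.
have q_ge0 (a : draw n K) : 0 <= draw_prob (1 / 2) (1 / 2) a :> R.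
  by case: a => *; rewrite !divr_ge0 // ?mulr_ge0.
have init0 := imbalance_init L0 sigma0 fL n0 K0 z0 ts_min.
have lyap_bound : tuple_mean (draw_prob (1 / 2) (1 / 2)) t
    (fun l => lyap f L sigma ts (walk l)) <=
    (1 - (n%:R * kappa * rate_constant)^-1) ^+ t *
      lyap f L sigma ts (tgd_init K f sigma z0).
  apply: (tuple_mean_foldl q_ge0 (V := lyap f L sigma ts) q0 (_ : forall s a,
    imbalance f sigma ts s = 0 -> _) _ _ init0).
    by move=> s a; rewrite imbalance_step.
  move=> s bal; apply: le_trans (mean_lyap_contracts L0 sigma0 fL n0 K0 Kn bal) _.
  apply: ler_wpM2r contraction_le.
  apply: le_trans (token_err_le_lyap ts L0 sigma0 fL n0 K0 s k).
  by rewrite mulr_ge0 ?dotxx_ge0 // ltW.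
rewrite [X in _ <= X]mulrC; apply: (@le_trans _ _ ((st * rho)^-1 *
    tuple_mean (draw_prob (1 / 2) (1 / 2)) t (fun l => lyap f L sigma ts (walk l)))).
  rewrite /tuple_mean [X in _ <= X]mulr_sumr; apply: ler_sum => l _.
  rewrite [X in _ <= X]mulrCA.
  apply: ler_wpM2l; first by apply: prodr_ge0.
  rewrite ler_pdivlMl // /err /= sqnormE.
  exact: (token_err_le_lyap ts L0 sigma0 fL n0 K0).
have V0 : 0 <= (st * rho)^-1 by rewrite invr_ge0 ltW.
apply: le_trans (ler_wpM2l V0 lyap_bound) _; rewrite mulrCA.
apply: ler_wpM2l; first exact: exprn_ge0.
by rewrite mulrC ler_norm.
Qed.

Section Counts.
Context {disp : measure_display} {Omega : measurableType disp}.
Variables (P : probability Omega R) (xi : nat -> Omega -> draw n K) (T : nat).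
Hypothesis xiP : iid_draws P (1 / 2) (1 / 2) xi.

Let a0 : draw n K := inr (Ordinal n0).

Lemma expected_gradient_steps (i : 'I_n) :
  ('E_P[fun w => (gradient_steps (xi ^~ w) T i)%:R] = (T%:R / (2 * n%:R))%:E)%E.
Proof.
have := expectation_count xiP a0 T (h := fun a => (a == inr i)%:R)
  (fun a => ler0n _ _) (sum_draw_prob n0 K0).
under [X in expectation _ X = _]eq_fun do rewrite -natr_sum.
move=> ->; congr (_%:E); congr (_ * _).
rewrite (bigD1 (inr i)) //= eqxx mulr1 big1 ?addr0 => [|a /negPf ->]; last by rewrite mulr0.
by rewrite mul1r -invfM.
Qed.

Lemma expected_token_jumps (k : 'I_K) :
  ('E_P[fun w => (token_jumps (xi ^~ w) T k)%:R] = (T%:R / (2 * K%:R))%:E)%E.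
Proof.
have := expectation_count xiP a0 T
  (h := fun a : draw n K => ([exists i : 'I_n, a == inl (i, k)] : nat)%:R)
  (fun a => ler0n _ _) (sum_draw_prob n0 K0).
under [X in expectation _ X = _]eq_fun do rewrite -natr_sum.
move=> ->; congr (_%:E); congr (_ * _).
rewrite big_sumType /= [X in _ + X]big1 ?addr0 => [|i _]; last first.
  by rewrite (_ : [exists _, _] = false) ?mulr0 //; apply/existsP => -[].
have -> : \sum_p 1 / 2 / (n%:R * K%:R) *
    ([exists i : 'I_n, inl p == inl (i, k) :> draw n K] : nat)%:R =
  \sum_(i < n) \sum_(j < K) 1 / 2 / (n%:R * K%:R) * (j == k)%:R :> R.
  rewrite pair_bigA; apply: eq_bigr => -[i j] _ /=; congr (_ * (nat_of_bool _)%:R).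
  apply/existsP/eqP => [[i' /eqP[_ ->]]//|->]; by exists i.
under eq_bigr => i _.
  rewrite (bigD1 k) //= eqxx mulr1 big1 ?addr0 => [|j /negPf ->]; last by rewrite mulr0.
  over.
rewrite sumr_const card_ord -(mulr_natl _ n).
by field; rewrite !pnatr_eq0 -!lt0n n0 K0.
Qed.

Lemma expected_total_jumps :
  ('E_P[fun w => (total_jumps (xi ^~ w) T)%:R] = (T%:R / 2)%:E)%E.
Proof.
have := expectation_count xiP a0 T
  (h := fun a : draw n K => (if a is inl _ then 1 else 0)%:R)
  (fun a => ler0n _ _) (sum_draw_prob n0 K0).
under [X in expectation _ X = _]eq_fun do rewrite -natr_sum.
have -> : (fun w => (\sum_(t < T) (if xi t w is inl _ then 1 else 0))%:R)
   = (fun w => (total_jumps (xi ^~ w) T)%:R : R).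
  apply/funext => w; congr (_%:R); rewrite /total_jumps /token_jumps exchange_big.
  apply: eq_bigr => t _; case: (xi t w) => [[i j]|i].
    rewrite (bigD1 j) //= big1 => [|k /negPf kj].
      by rewrite (_ : [exists _, _] = true) //; apply/existsP; exists i.
    rewrite (_ : [exists _, _] = false) //; apply/existsP => -[i' /eqP[_ jk]].
    by rewrite jk eqxx in kj.
  by rewrite big1 // => k _; rewrite (_ : [exists _, _] = false) //; apply/existsP => -[].
move=> ->; congr (_%:E); congr (_ * _).
rewrite big_sumType /= [X in _ + X]big1 ?addr0 => [|i _]; last by rewrite mulr0.
rewrite mulr1 sumr_const card_prod !card_ord -(mulr_natl _ (n * K)) natrM.
by field; rewrite !pnatr_eq0 -!lt0n n0 K0.
Qed.

End Counts.
End Convergence.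

Theorem theorem2 (R : realType) (kappa0 : R) (hkappa0 : 1 < kappa0) :
  exists C : R, 0 < C /\
  forall (n d : nat) (f : 'I_n -> 'rV[R]_d -> R) (L sigma : R)
         (theta_star : 'rV[R]_d) (z0 : 'I_n -> 'rV[R]_d),
    0 < L -> 0 < sigma ->
    (forall i, local_function L (f i)) ->
    is_minimizer (regularized_objective f sigma) theta_star ->
    let kappa := 1 + L / sigma in
    kappa0 <= kappa ->
    exists C0 : R, 0 < C0 /\
    forall (K : nat) (eps : R), (1 <= K <= n)%N -> 0 < eps ->
      let log_factor := Num.max 0 (ln (C0 / eps)) in
      exists T : nat,
      forall (disp : measure_display) (Omega : measurableType disp)
             (P : probability Omega R) (xi : nat -> Omega -> draw n K),
        let p_comm : R := 1 / 2 in
        let p_comp : R := 1 / 2 in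
        iid_draws P p_comm p_comp xi ->
        let theta_token t k w :=
          token_theta (tgd f L sigma p_comm p_comp z0 (xi ^~ w) t) k in
        [/\ forall (t : nat) (k : 'I_K), (T <= t)%N ->
              ('E_P[fun w => sqnorm (theta_token t k w - theta_star)]
                 <= eps%:E)%E,
            forall i : 'I_n,
              ('E_P[fun w => (gradient_steps (xi ^~ w) T i)%:R]
                 <= (C * kappa * log_factor)%:E)%E,
            forall k : 'I_K,
              ('E_P[fun w => (token_jumps (xi ^~ w) T k)%:R]
                 <= (C * (n%:R / K%:R) * kappa * log_factor)%:E)%E &
            ('E_P[fun w => (total_jumps (xi ^~ w) T)%:R]
               <= (C * n%:R * kappa * log_factor)%:E)%E].
Proof.
exists (rate_constant kappa0); have A1 := rate_constant_ge1 hkappa0.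
have A0 := lt_le_trans ltr01 A1; split=> // n d f L sigma ts z0 L0 sigma0 fL ts_min.
move=> kappa kappa0_le.
have kap1 : 1 <= kappa by rewrite lerDl divr_ge0 // ltW.
have kap0 := lt_le_trans ltr01 kap1.
(* The initialization constant must serve every K at once: a sum over all
   possible K bounds each of its terms. *)
pose amplitude K := `|lyap f L sigma ts (tgd_init K f sigma z0) /
  (@sigma_tilde R n K sigma *
   (@sigma_tilde R n K sigma / (L + @sigma_tilde R n K sigma)))|.
pose C1 := 1 + \sum_(K < n.+1) amplitude K.
have C1_gt0 : 0 < C1 by apply: ltr_pwDl => //; apply: sumr_ge0 => K _; exact: normr_ge0.
exists (expR 1 * C1); split; first by rewrite mulr_gt0 ?expR_gt0.
move=> K eps K_range eps0 log_factor.
have K0 : (0 < K)%N by case/andP: K_range.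
have Kn : (K <= n)%N by case/andP: K_range.
have n0 : (0 < n)%N by exact: leq_trans Kn.
have n1 : 1 <= n%:R :> R by rewrite ler1n.
have N0 := lt_le_trans ltr01 n1.
have k0 : 0 < K%:R :> R by rewrite ltr0n.
pose r := n%:R * kappa * rate_constant kappa0.
have r1 : 1 <= r by rewrite mulr_ege1 // mulr_ege1.
have [T [T_err T_le]] := geometric_stopping_time C1_gt0 r1 eps0.
exists T => disp Omega P xi p_comm p_comp xiP theta_token.
have T0 : 0 <= T%:R :> R by [].
have le_T (c : R) : 0 < c -> T%:R / (2 * c) <=
    rate_constant kappa0 * (n%:R / c) * kappa * log_factor.
  move=> c0; rewrite ler_pdivrMr ?mulr_gt0 //; apply: le_trans T_le _.
  have lf0 : 0 <= r * log_factor.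
    by rewrite mulr_ge0 ?le_max ?lexx // ltW // (lt_le_trans _ r1).
  have -> : rate_constant kappa0 * (n%:R / c) * kappa * log_factor * (2 * c) =
      2 * (r * log_factor) by rewrite /r; field; rewrite gt_eqF.
  by rewrite ler_peMl // ler1n.
split.
- move=> t k Tt.
  apply: le_trans (expected_token_error z0 L0 sigma0 fL ts_min hkappa0 kappa0_le
    K_range t k xiP) _.
  rewrite lee_fin; apply: le_trans (T_err t Tt).
  apply: ler_wpM2r.
    by rewrite exprn_ge0 // subr_ge0 invf_le1 // (lt_le_trans _ r1).
  have Kn1 : (K < n.+1)%N by rewrite ltnS.
  rewrite /C1 (bigD1 (Ordinal Kn1)) //= addrCA lerDl addr_ge0 //.
  by apply: sumr_ge0 => K' _; exact: normr_ge0.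
- move=> i; rewrite (expected_gradient_steps K_range T xiP) lee_fin.
  by have := le_T _ N0; rewrite divff ?gt_eqF // mulr1.
- move=> k; rewrite (expected_token_jumps K_range T xiP) lee_fin; exact: le_T.
- rewrite (expected_total_jumps K_range T xiP) lee_fin.
  by have := le_T 1 ltr01; rewrite mulr1 divr1.
Qed.
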